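(* Let $G$ be a compact Hausdorff topological group and let $D: G \to [0,\infty)$ be a continuous function. If there is a regular Borel probability measure $\nu$ on $G$ such that $\nu$ is $D$-dominating, then the normalized Haar measure $\sigma_G$ on $G$ is $D$-dominating.
   Context: The group operation on $G$ is written multiplicatively. A Haar measure on $G$ is a nonzero Radon measure $\mu$ with $\mu(\psi B)=\mu(B)$ for every $\psi \in G$ and every Borel set $B \subseteq G$; $\sigma_G$ denotes the unique Haar measure on $G$ with $\sigma_G(G)=1$. For a continuous function $D: G\to[0,\infty)$, a regular Borel probability measure $\nu$ on $G$ is called $D$-dominating if $1 \le \int_G D(\psi\varphi)\, d\nu(\varphi)$ for all $\psi\in G$. *)

(* Defs.v *)
From HB Require Import structures.
From mathcomp Require Import all_boot all_order all_algebra.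
From mathcomp Require Import all_classical all_reals all_analysis.

Set Implicit Arguments.
Unset Strict Implicit.
Unset Printing Implicit Defensive.

Import Order.TTheory GRing.Theory Num.Theory.
Import numFieldNormedType.Exports.

Local Open Scope classical_set_scope.
Local Open Scope ring_scope.
Local Open Scope ereal_scope.

HB.mixin Record isTopologicalGroup G & Topological G & Group G := {
  mulg_continuous : continuous (fun x : G * G => (x.1 * x.2)%g) ;
  invg_continuous : continuous (fun x : G => (x^-1)%g)
}.

#[short(type="topologicalGroupType")]
HB.structure Definition TopologicalGroup :=
  {G of Topological G & Group G & isTopologicalGroup G}.

(* G itself, pointed by 1: g_sigma_algebraType only yields a measurable type
   over a pointed carrier. *)
Definition pointed_group (G : topologicalGroupType) : Type := G.

HB.instance Definition _ (G : topologicalGroupType) :=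
  TopologicalGroup.on (pointed_group G).
HB.instance Definition _ (G : topologicalGroupType) :=
  isPointed.Build (pointed_group G) (1%g : G).

Notation borelType G := (g_sigma_algebraType (@open (pointed_group G))).

Section borel_measures.
Variables (R : realType) (G : topologicalGroupType).
Implicit Types (mu : {measure set (borelType G) -> \bar R}) (A : set G).

Definition outer_regular_on mu A :=
  mu A = ereal_inf [set mu U | U in [set U : set G | open U /\ A `<=` U]].

Definition inner_regular_on mu A :=
  mu A = ereal_sup [set mu K | K in [set K : set G | compact K /\ K `<=` A]].

Definition regular_measure mu :=
  forall B : set (borelType G), measurable B ->
    outer_regular_on mu B /\ inner_regular_on mu B.

Definition radon_measure mu :=
  [/\ forall K : set G, compact K -> mu K < +oo,
      forall B : set (borelType G), measurable B -> outer_regular_on mu B &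
      forall U : set G, open U -> inner_regular_on mu U].

Definition haar_measure mu :=
  [/\ radon_measure mu,
      exists2 B : set (borelType G), measurable B & mu B != 0 &
      forall (psi : G) (B : set (borelType G)), measurable B ->
        mu [set (psi * x)%g | x in B] = mu B].

Definition dominating (D : G -> R) (nu : probability (borelType G) R) :=
  regular_measure nu /\
  forall psi : G, 1 <= \int[nu]_(phi in [set: borelType G]) (D (psi * phi)%g)%:E.

End borel_measures.

(* Main.v *)
(** Write [c] for the integral of [D] and [c'] for that of [x |-> D x^-1] against
    a left-invariant probability [sigma]. Integrating the constraints
    [a <= \int D (psi^-1 * phi) dmu(phi)] over [psi] against [sigma] and exchanging
    the integrals gives [a <= c'], because the inner integral over [psi] is [c']
    for every [phi]. With [mu = nu] and [a = 1] this is [1 <= c']; with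
    [mu = sigma], [D] replaced by [x |-> D x^-1] and [a = c'], it is [c' <= c].
    Fubini's theorem is not used: [G] need not be second countable, so the Borel
    sets of [G * G] may be more than the product sigma-algebra. By uniform
    continuity of [D], [mu] is instead replaced, up to [e], by a finite sum of
    point masses. *)

Require Import Defs.
From HB Require Import structures.
From mathcomp Require Import all_boot all_order all_algebra.
From mathcomp Require Import all_classical all_reals all_analysis.
From mathcomp Require Import measurable_realfun lra.

Set Implicit Arguments.
Unset Strict Implicit.
Unset Printing Implicit Defensive.

Import Order.TTheory GRing.Theory Num.Theory.
Import numFieldNormedType.Exports.

Local Open Scope classical_set_scope.
Local Open Scope ring_scope.

Lemma continuous_mulg (T : topologicalType) (G : topologicalGroupType)
    (u v : T -> G) :
  continuous u -> continuous v -> continuous (fun x => (u x * v x)%g).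
Proof.
move=> cu cv x.
apply: (continuous_comp (f := fun x => (u x, v x))
  (g := fun p : G * G => (p.1 * p.2)%g)); last exact: mulg_continuous.
by apply: cvg_pair; [exact: cu|exact: cv].
Qed.

Lemma continuous_invg (T : topologicalType) (G : topologicalGroupType)
    (u : T -> G) :
  continuous u -> continuous (fun x => (u x)^-1%g).
Proof.
by move=> cu x; apply: continuous_comp; [exact: cu|exact: invg_continuous].
Qed.

Lemma integral_probability_cst d (T : measurableType d) (R : realType)
    (P : probability T R) (c : \bar R) :
  (\int[P]_(x in [set: T]) c = c)%E.
Proof. by rewrite integral_cst//= probability_setT mule1. Qed.

(** Turns an outer approximation [B] of the complement of [A] into an inner approximation of [A] by
    the complement of [B]. *)
Lemma probability_setC_lt d (T : measurableType d) (R : realType)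
    (P : probability T R) (A B : set T) (e : R) :
  measurable A -> measurable B ->
  (P B < P (~` A) + e%:E -> P A <= P (~` B) + e%:E)%E.
Proof.
move=> mA mB; rewrite !probability_setC//.
have finA : P A \is a fin_num := fin_num_measure P _ mA.
have finB : P B \is a fin_num := fin_num_measure P _ mB.
rewrite -(fineK finA) -(fineK finB) -!(EFinB, EFinD) lte_fin lee_fin.
lra.
Qed.

(** * Borel measurability of continuous maps *)

Section continuous_borel.
Variables (R : realType) (G : topologicalGroupType).

Lemma open_borel_measurable (U : set G) :
  open U -> measurable (U : set (borelType G)).
Proof. by move=> oU; exact: sub_sigma_algebra. Qed.

Lemma closed_borel_measurable (F : set G) :
  closed F -> measurable (F : set (borelType G)).
Proof.
move=> cF; rewrite -(setCK F); apply: measurableC.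
by apply: open_borel_measurable; exact: closed_openC.
Qed.

Lemma continuous_borel_measurable (h : G -> G) :
  continuous h ->
  measurable_fun [set: borelType G] (h : borelType G -> borelType G).
Proof.
move=> /continuousP ch.
apply: (@measurability _ _ (borelType G) (borelType G) _ _
  (@open (pointed_group G))) => //.
move=> _ [U oU <-]; rewrite setTI; apply: open_borel_measurable; exact: ch.
Qed.

Lemma continuous_EFin_measurable (f : G -> R) :
  continuous f ->
  measurable_fun [set: borelType G] ((EFin \o f) : borelType G -> \bar R).
Proof.
move=> /continuousP cf; apply/measurable_EFinP.
apply: (@measurability _ _ (borelType G) R _ _ (RGenOpens.G (R:=R))).
  exact: RGenOpens.measurableE.
move=> _ [_ [a [b ->]] <-]; rewrite setTI; apply: open_borel_measurable.
exact/cf/interval_open.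
Qed.

End continuous_borel.

(** * Integration against a left-invariant probability *)

Section left_invariant.
Local Open Scope ereal_scope.
Variables (R : realType) (G : topologicalGroupType).
Variable sigma : probability (borelType G) R.
Hypothesis sigma_left_invariant :
  forall (psi : G) (B : set (borelType G)), measurable B ->
    sigma [set (psi * x)%g | x in B] = sigma B.

Lemma integral_left_invariant (f : G -> R) (psi : G) :
  continuous f -> (forall x, 0 <= f x)%R ->
  \int[sigma]_(x in [set: borelType G]) (f (psi * x)%g)%:E =
  \int[sigma]_(x in [set: borelType G]) (f x)%:E.
Proof.
move=> cf f0.
pose h (x : borelType G) : borelType G := (psi * x)%g.
have mh : measurable_fun [set: borelType G] h.
  apply: continuous_borel_measurable; apply: continuous_mulg => x.
    exact: cvg_cst.
  exact: cvg_id.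
pose tau : {measure set (borelType G) -> \bar R} := pushforward sigma h.
transitivity (\int[tau mh]_(x in [set: borelType G]) (f x)%:E).
  rewrite (ge0_integral_pushforward mh)//.
  - exact: continuous_EFin_measurable.
  - by move=> x _; rewrite lee_fin.
apply: eq_measure_integral => A mA _.
(* The preimage of [A] under left translation by [psi] is the translate of [A] by [psi^-1], so the
   pushforward of [sigma] is [sigma] itself. *)
apply/esym/(etrans (esym (sigma_left_invariant (psi^-1)%g mA))).
congr (sigma _); apply/seteqP; split => [_ [x Ax <-]|x Ax] /=.
  by rewrite /h mulVKg.
by exists (psi * x)%g => //; rewrite mulKg.
Qed.

Hypothesis compactG : compact [set: G].
Variables (f : G -> R).
Hypotheses (continuousf : continuous f) (f_ge0 : forall x, (0 <= f x)%R).

Let continuous_comp_f (T : topologicalType) (u : T -> G) :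
  continuous u -> continuous (fun x => f (u x)).
Proof.
by move=> cu x; apply: continuous_comp; [exact: cu|exact: continuousf].
Qed.

(** Since [x^-1 * phi] is the inverse of [phi^-1 * x], inversion turns this right translation into a
    left one. *)
Lemma integral_inv_translate (phi : G) :
  \int[sigma]_(x in [set: borelType G]) (f (x^-1 * phi)%g)%:E =
  \int[sigma]_(x in [set: borelType G]) (f x^-1%g)%:E.
Proof.
rewrite -(@integral_left_invariant (fun x => f x^-1%g) phi^-1%g)//; last first.
  by apply/continuous_comp_f/continuous_invg => x; exact: cvg_id.
by apply: eq_integral => x _; rewrite invgM invgK.
Qed.

(** A tube argument: the difference of the two values is jointly continuous and vanishes at
    [phi = phi0], and compactness of [G] makes the neighbourhood of [phi0] independent of [psi]. *)
Lemma translates_locally_le (e : R) (phi0 : G) : (0 < e)%R ->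
  \forall phi \near phi0, forall psi,
    (f (psi * phi)%g <= f (psi * phi0)%g + e)%R.
Proof.
move=> e0.
have cF : continuous (fun p : G * G =>
    f (p.1 * p.2)%g - f (p.1 * phi0)%g)%R.
  move=> p; apply: continuousB; apply: continuous_comp_f;
    apply: continuous_mulg => q.
  - exact: cvg_fst.
  - exact: cvg_snd.
  - exact: cvg_fst.
  - exact: cvg_cst.
have near_phi0 (psi0 : G) : [set: G] psi0 ->
    \forall psi \near psi0 & phi \near phi0,
    (f (psi * phi)%g <= f (psi * phi0)%g + e)%R.
  move=> _; have := cF (psi0, phi0) [set x | x < e]%R.
  rewrite /= subrr => /(_ (lt_nbhsl e0)).
  apply: (@filterS _ (nbhs (psi0, phi0))) => -[psi phi] /=.
  by rewrite ltrBlDl => /ltW.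
have := (compact_near_coveringP [set: G]).1 compactG _ (nbhs phi0)
  (fun phi psi => (f (psi * phi)%g <= f (psi * phi0)%g + e)%R) _ near_phi0.
by move=> /(_ _); apply: filterS => phi + psi; exact.
Qed.

(* [g] stands in for the inner integral as a function of [psi], whose
   measurability is thereby never needed. *)
Lemma cover_domination (mu : probability (borelType G) R) (e : R)
    (U : G -> set G) (s : seq G) (A : set (borelType G)) :
  (0 < e)%R -> (forall i, open (U i)) ->
  (forall i phi psi, U i phi -> (f (psi * phi)%g <= f (psi * i)%g + e)%R) ->
  measurable A -> A `<=` [set phi | exists2 i, i \in s & U i phi] ->
  exists g : borelType G -> \bar R,
    [/\ measurable_fun [set: borelType G] g, forall psi, 0 <= g psi,
        forall psi, \int[mu]_(phi in A) (f (psi^-1 * phi)%g)%:E <= g psi &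
        \int[sigma]_(psi in [set: borelType G]) g psi <=
          (\int[sigma]_(x in [set: borelType G]) (f x^-1%g)%:E + e%:E) * mu A].
Proof.
(* The induction on [s] keeps [A] general: the head [i] takes care of the part of [A] in [U i], the
   tail of the rest. *)
move=> e0 oU fU; elim: s A => [|i s IHs] A mA sA.
  have -> : A = set0 by apply/seteqP; split => // x /sA[].
  exists (cst 0); split => //.
  - by move=> psi; rewrite integral_set0.
  - by rewrite integral0 measure0 mule0.
have mU : measurable (U i : set (borelType G)) by exact: open_borel_measurable.
have mAU := measurableI _ _ mA mU; have mAD := measurableD mA mU.
have [|g [mg g0 gA gI]] := IHs (A `\` U i) mAD.
  by move=> x [/sA[j]]; rewrite inE => /predU1P[->//|js Ujx _]; exists j.
have cfi : continuous (fun x : G => f (x^-1 * i)%g).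
  apply/continuous_comp_f/continuous_mulg; first exact: invg_continuous.
  by move=> x; exact: cvg_cst.
have mfi := continuous_EFin_measurable cfi.
(* On [A] within [U i], [mu] is replaced by a point mass at [i]; the error is at most [e] times the
   mass moved. *)
exists (fun psi => ((f (psi^-1 * i)%g)%:E + e%:E) * mu (A `&` U i) + g psi).
have fe0 psi : 0 <= (f (psi^-1 * i)%g)%:E + e%:E.
  by rewrite -EFinD lee_fin addr_ge0// ltW.
split.
- apply: emeasurable_funD => //; apply: emeasurable_funM => //.
  exact: emeasurable_funD.
- by move=> psi; rewrite adde_ge0// mule_ge0.
- move=> psi.
  have cf : continuous (fun phi : G => f (psi^-1 * phi)%g).
    apply/continuous_comp_f/continuous_mulg => x; first exact: cvg_cst.
    exact: cvg_id.
  have mf := continuous_EFin_measurable cf.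
  rewrite -{1}(setUIDK A (U i)) ge0_integral_setU//.
  + apply: leeD => //.
    rewrite -integral_cst//; apply: ge0_le_integral => //.
    - by move=> x _; rewrite lee_fin.
    - exact: measurable_funTS.
    - by move=> x [_ Ux]; rewrite -EFinD lee_fin; exact: fU.
  + exact: measurable_funTS.
  + by move=> x _; rewrite lee_fin.
  + by apply/disj_setPS => x [[_ Ux] [_ /(_ Ux)]].
- rewrite ge0_integralD//; last 2 first.
    by move=> psi _; rewrite mule_ge0.
    apply: emeasurable_funM => //; exact: emeasurable_funD.
  rewrite ge0_integralZr//; last exact: emeasurable_funD.
  rewrite ge0_integralD//; last by move=> x _; rewrite lee_fin ltW.
    (* The integral of the first factor over [psi] does not depend on [i], so the masses of the two
       pieces share one coefficient and add up to [mu A]. *)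
    rewrite integral_inv_translate integral_probability_cst.
    rewrite -{2}(setUIDK A (U i)) measureU//; last first.
      by apply/seteqP; split => // x [[_ Ux] [_ /(_ Ux)]].
    by rewrite ge0_muleDr// leeD.
  by move=> x _; rewrite lee_fin.
Qed.

Lemma ge0_le_integral_inv (mu : probability (borelType G) R) (a : \bar R) :
  0 <= a ->
  (forall psi, a <= \int[mu]_(phi in [set: borelType G]) (f (psi * phi)%g)%:E) ->
  a <= \int[sigma]_(x in [set: borelType G]) (f x^-1%g)%:E.
Proof.
move=> a0 amu; apply/lee_addgt0Pr => e e0.
have /choice[U UP] : forall i : G, exists U : set G, [/\ open U, U i &
    forall phi psi, U phi -> (f (psi * phi)%g <= f (psi * i)%g + e)%R].
  move=> i; have : nbhs i _ := translates_locally_le i e0.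
  rewrite nbhsE => -[U [oU Ui] UP]; exists U; split => // phi psi /UP; exact.
have cG : compact [set: pointed_group G] := compactG.
move: cG; rewrite compact_cover => /(_ G setT U)[].
- by move=> i _; have [] := UP i.
- by move=> i _; exists i => //; have [] := UP i.
move=> s _ scover.
have [//||||g [mg g0 gA gI]] :=
  @cover_domination mu e U (finmap.enum_fset s) setT e0.
- by move=> i; have [] := UP i.
- by move=> i phi psi; have [_ _] := UP i; exact.
- by [].
- by move=> x _; have [i /= si Ui] := scover x I; exists i.
move: gI; rewrite [mu _](probability_setT mu) mule1; apply: le_trans.
(* Writing [a] as the [sigma]-integral of a constant allows a comparison pointwise in [psi], with
   the constraint taken at [psi^-1]. *)
rewrite -[leLHS](integral_probability_cst sigma).
apply: ge0_le_integral => // psi _; exact: le_trans (amu psi^-1%g) (gA psi).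
Qed.

End left_invariant.

(** Outer regularity of the complement of [B] gives an open [U] around it; the complement of [U] is
    closed, hence compact, and fills [B] up to [e]. *)
Lemma radon_regular (R : realType) (G : topologicalGroupType)
    (mu : probability (borelType G) R) :
  compact [set: G] -> hausdorff_space G -> radon_measure mu ->
  regular_measure mu.
Proof.
move=> compactG hausdorffG [_ outer _] B mB; split; first exact: outer.
apply/eqP; rewrite eq_le; apply/andP; split; last first.
  apply: ge_ereal_sup => _ [K [cK KB] <-].
  apply: (le_measure mu); rewrite ?inE//.
  by apply: closed_borel_measurable; exact: compact_closed.
apply/lee_addgt0Pr => e e0.
have mBc := measurableC mB.
have finBc := fin_num_measure mu _ mBc.
have outerBc : _ = ereal_inf _ := outer _ mBc.
have := finBc; rewrite outerBc => /(lb_ereal_inf_adherent e0)[_ [U [oU BU] <-]].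
rewrite -outerBc => Ulte.
have mU := open_borel_measurable oU.
have UcB : ~` U `<=` B by rewrite -(setCK B); exact: subsetC.
have cUc : compact (~` U).
  by apply: (subclosed_compact _ compactG) => //; exact: open_closedC.
apply: (@le_trans _ _ (mu (~` U) + e%:E)%E); last first.
  by rewrite leeD2r//; apply: ereal_sup_ubound; exists (~` U).
exact: probability_setC_lt Ulte.
Qed.

Theorem theorem3p2 (R : realType) (G : topologicalGroupType)
    (compactG : compact [set: G]) (hausdorffG : hausdorff_space G)
    (D : G -> R) (continuousD : continuous D) (D_ge0 : forall x : G, 0 <= D x) :
  (exists nu : probability (borelType G) R, dominating D nu) ->
  forall sigma : probability (borelType G) R,
    haar_measure sigma -> dominating D sigma.
Proof.
move=> [nu [_ nuD]] sigma [radon_sigma _ inv_sigma].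
split; first exact: radon_regular compactG hausdorffG radon_sigma.
(* By left invariance all the constraints on [sigma] are the single inequality that the integral of
   [D] is at least 1. *)
move=> psi; rewrite integral_left_invariant//.
have cDinv : continuous (fun x : G => D x^-1%g).
  move=> x; apply: continuous_comp; first exact: invg_continuous.
  exact: continuousD.
apply: (@le_trans _ _ (\int[sigma]_(x in [set: borelType G]) (D x^-1%g)%:E)%E).
  exact: ge0_le_integral_inv nuD.
rewrite [leRHS](_ : _ =
    \int[sigma]_(x in [set: borelType G]) (D (x^-1)^-1%g)%:E)%E; last first.
  by apply: eq_integral => x _; rewrite invgK.
(* For [x |-> D x^-1] the constraints against [sigma] hold with equality, by left invariance. *)
apply: (ge0_le_integral_inv inv_sigma compactG cDinv _ (mu := sigma)) => //.
  by apply: integral_ge0 => x _; rewrite lee_fin.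
by move=> phi; rewrite (integral_left_invariant inv_sigma _ cDinv).
Qed.
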